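(* Fix $c\in(0,\infty)$. Let $E=\mathbb{C}\times L^1([-2,0];\mathbb{C})$ (a Banach lattice with the componentwise order) and define $A$ on $E$ by $D(A)=\{(x,f)\in\mathbb{C}\times W^{1,1}((-2,0);\mathbb{C}) : f(0)=x\}$, $A(x,f)=(\langle\Phi,f\rangle, f')$, where $\langle\Phi,f\rangle = c\Big(\int_{-2}^{-1} f(s)\,ds - \int_{-1}^0 f(s)\,ds + f(-2) - f(0)\Big)$. Let $u:=(1,\mathbb{1}_{[-2,0]})\in E$ and let $\varphi=(1,c\mathbb{1})\in E'$, i.e. $\langle\varphi,(x,f)\rangle = x + c\int_{-2}^0 f(s)\,ds$. Then: (1) there is $\varepsilon>0$ such that $(0,\varepsilon)\subseteq\rho(A)$ and $R(\mu,A)\succeq u\otimes\varphi$ for all $\mu\in(0,\varepsilon)$; (2) there is $\varepsilon>0$ such that $(-\varepsilon,0)\subseteq\rho(A)$ and $R(\mu,A)\preceq -u\otimes\varphi$ for all $\mu\in(-\varepsilon,0)$.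
   Context: $R(\mu,A)=(\mu-A)^{-1}$. $u\otimes\varphi$ is the operator $h\mapsto\langle\varphi,h\rangle u$. For bounded real operators $T,S$ on $E$, $T\succeq S$ (equivalently $S\preceq T$) means there is $c'>0$ such that $T-c'S$ maps the positive cone $E_+$ into itself. *)

(* Defs.v *)
From HB Require Import structures.
From mathcomp Require Import all_boot all_order all_algebra.
From mathcomp Require Import all_classical all_reals all_analysis.
From mathcomp Require Import complex.
Set Implicit Arguments. Unset Strict Implicit. Unset Printing Implicit Defensive.
Import Order.TTheory GRing.Theory Num.Theory.
Import numFieldNormedType.Exports.
Local Open Scope classical_set_scope.
Local Open Scope ring_scope.
Local Open Scope complex_scope.

Section Defs.
Variable R : realType.
Local Notation C := R[i].
Local Notation mu := (@lebesgue_measure R).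

(** Elements of E = C x L^1([-2,0];C), given by a representative:
    a pair (x, f) with f : R -> C (only its values on [-2,0] matter). *)
Definition Elt := (C * (R -> C))%type.

Definition I02 : set R := `[(-2)%R, 0%R].

Definition cintegrable (D : set R) (f : R -> C) :=
  mu.-integrable D (fun t => (complex.Re (f t))%:E) /\
  mu.-integrable D (fun t => (complex.Im (f t))%:E).

Definition cint (D : set R) (f : R -> C) : C :=
  Complex (Rintegral mu D (fun t => complex.Re (f t))) (Rintegral mu D (fun t => complex.Im (f t))).

Definition inE (h : Elt) := cintegrable I02 h.2.

Definition aeI (P : R -> Prop) := mu.-negligible [set t | I02 t /\ ~ P t].

Definition eqE (h1 h2 : Elt) := h1.1 = h2.1 /\ aeI (fun t => h1.2 t = h2.2 t).

(** positive cone E_+ (componentwise order; 0 <= z in C means z real >= 0) *)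
Definition posE (h : Elt) := 0 <= h.1 /\ aeI (fun t => 0 <= h.2 t).

Definition normE (h : Elt) : C := `|h.1| + cint I02 (fun t => `|h.2 t|).

Definition addE (h1 h2 : Elt) : Elt := (h1.1 + h2.1, fun t => h1.2 t + h2.2 t).
Definition scaleE (a : C) (h : Elt) : Elt := (a * h.1, fun t => a * h.2 t).

(** D(A): (x,f) with f in W^{1,1}(-2,0) and f(0) = x.  In one dimension,
    f in W^{1,1}(-2,0) with weak derivative g in L^1 means f coincides a.e.
    with the absolutely continuous function F(t) = F(0) - \int_t^0 g;
    the trace f(0) is F(0).  [inDA h g] says h in D(A) with f' = g. *)
Definition inDA (h : Elt) (g : R -> C) :=
  inE h /\ cintegrable I02 g /\
  aeI (fun t => h.2 t = h.1 - cint `[t, 0%R] g).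

Definition trace_m2 (h : Elt) (g : R -> C) : C := h.1 - cint I02 g.

Definition PhiA (c : R) (h : Elt) (g : R -> C) : C :=
  c%:C * (cint `[(-2)%R, (-1)%R] h.2 - cint `[(-1)%R, 0%R] h.2
          + trace_m2 h g - h.1).

Definition graphA (c : R) (h z : Elt) :=
  exists g, inDA h g /\ eqE z (PhiA c h g, g).

Definition res (c : R) (m : C) (k h : Elt) :=
  exists z, graphA c h z /\ eqE (addE (scaleE m h) (scaleE (-1) z)) k.

Definition in_resolvent_set (c : R) (m : C) :=
  (forall k, inE k -> exists h, res c m k h) /\
  (forall k h1 h2, inE k -> res c m k h1 -> res c m k h2 -> eqE h1 h2) /\
  (exists M : R, forall k h, inE k -> res c m k h ->
      normE h <= M%:C * normE k).

Definition uE : Elt := (1, fun _ => 1).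
Definition phiE (c : R) (k : Elt) : C := k.1 + c%:C * cint I02 k.2.

(** operators given by their graphs (relations k |-> h, representatives) *)
Definition rank1 (c : R) (k h : Elt) := eqE h (scaleE (phiE c k) uE).
Definition neg_op (T : Elt -> Elt -> Prop) (k h : Elt) :=
  exists w, T k w /\ eqE h (scaleE (-1) w).

Definition positive_op (T : Elt -> Elt -> Prop) :=
  forall k h, inE k -> posE k -> T k h -> posE h.

Definition op_succeq (T S : Elt -> Elt -> Prop) :=
  exists c' : R, 0 < c' /\
    positive_op (fun k h => exists w v, T k w /\ S k v /\
                   eqE h (addE w (scaleE (- c'%:C) v))).

End Defs.

(* Main.v *)
(** For real [m <> 0], the equation [(m - A)(x, f) = (y, k)] forces
    [f t = e^(m t) (x + \int_t^0 e^(-m s) k(s) ds)].  Integrating [f' = m f - k]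
    over [-2, -1] and [-1, 0] eliminates the integrals of [f] from the functional
    [Phi] and leaves the scalar equation [charP * x = m * y + c * forcing k], where
    [charP >= m ^ 2] and [forcing k] is the integral of [k] against a weight.
    For small [m] this weight is bounded by [m / 2], from below if [m > 0] and from
    above if [m < 0], so [x] has the sign of [m] and controls [m * phi(y, k)].
    As [charP] is of order [m ^ 2], [x] dominates the bounded contribution of [k]
    to [f] when [m] is close to [0].  Since [m] is real, the real and imaginary
    parts of the problem decouple. *)

Require Import Defs.
From HB Require Import structures.
From mathcomp Require Import all_boot all_order all_algebra.
From mathcomp Require Import all_classical all_reals all_analysis.
From mathcomp Require Import measurable_realfun complex ring lra.
Import Order.TTheory GRing.Theory Num.Theory.
Import numFieldNormedType.Exports.
Local Open Scope classical_set_scope.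
Local Open Scope ring_scope.

(** * Exchange of the order of integration over the triangle [a <= s <= r <= b] *)

Section triangle.
Context {R : realType}.
Notation mu := (@lebesgue_measure R).
Implicit Types (a b : R) (p k : R -> R).

Let integrable_patch_itv a b k : mu.-integrable `[a, b] (EFin \o k) ->
  mu.-integrable setT (EFin \o (k \_ `[a, b])).
Proof.
by move=> ik; rewrite -restrict_EFin; apply: (integrable_mkcond _ _).1.
Qed.

(** Extension by zero turns integrals over the triangle into integrals over the whole plane, where
    Fubini's theorem applies directly. *)
Let kernel a b p k (z : R * R) : R :=
  (p \_ `[a, b]) z.1 * (k \_ `[a, b]) z.2 * \1_[set w : R * R | w.1 <= w.2] z.

Let kernel_section1 a b p k s r : s \in `[a, b] ->
  kernel a b p k (s, r) = p s * (k \_ `[s, b]) r.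
Proof.
move=> sab; rewrite /kernel /= patchE mem_set// -mulrA; congr (_ * _).
rewrite !patchE indicE/=; move: sab; rewrite in_itv/= => /andP[as_ sb].
have [sr|rs] := leP s r.
  rewrite (mem_set (_ : [set w : R * R | w.1 <= w.2] (s, r)))// mulr1.
  case: ifPn => [|]; rewrite ?inE ?notin_setE/= !in_itv/=.
    by move=> /andP[ar rb]; rewrite mem_set//= in_itv/= sr rb.
  move=> h; rewrite memNset//= in_itv/= sr/= => rb; apply: h.
  by rewrite rb (le_trans as_ sr).
rewrite (memNset (_ : ~ [set w : R * R | w.1 <= w.2] (s, r))); last first.
  by rewrite /= leNgt rs.
by rewrite mulr0 memNset//= in_itv/= leNgt rs.
Qed.

Let kernel_section2 a b p k s r : r \in `[a, b] ->
  kernel a b p k (s, r) = k r * (p \_ `[a, r]) s.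
Proof.
move=> rab; rewrite /kernel /= [X in _ * X * _]patchE mem_set//.
rewrite [in LHS](mulrC _ (k r)) -mulrA; congr (_ * _).
rewrite !patchE indicE/=; move: rab; rewrite in_itv/= => /andP[ar rb].
have [sr|rs] := leP s r.
  rewrite (mem_set (_ : [set w : R * R | w.1 <= w.2] (s, r)))// mulr1.
  case: ifPn => [|]; rewrite ?inE ?notin_setE/= !in_itv/=.
    by move=> /andP[as_ sb]; rewrite mem_set//= in_itv/= sr as_.
  move=> h; rewrite memNset//= in_itv/= sr/= andbT => as_; apply: h.
  by rewrite as_ (le_trans sr rb).
rewrite (memNset (_ : ~ [set w : R * R | w.1 <= w.2] (s, r))); last first.
  by rewrite /= leNgt rs.
by rewrite mulr0 memNset//= in_itv/= (leNgt s) rs andbF.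
Qed.

Let kernel_integrable a b p k :
  mu.-integrable `[a, b] (EFin \o p) -> mu.-integrable `[a, b] (EFin \o k) ->
  (mu \x mu)%E.-integrable setT (EFin \o kernel a b p k).
Proof.
move=> ip ik.
have Ip := integrable_patch_itv _ _ _ ip.
have Ik := integrable_patch_itv _ _ _ ik.
have mp : measurable_fun setT (p \_ `[a, b]) by apply/measurable_EFinP; exact: measurable_int Ip.
have mk : measurable_fun setT (k \_ `[a, b]) by apply/measurable_EFinP; exact: measurable_int Ik.
have mT : measurable [set w : R * R | w.1 <= w.2].
  have := @measurable_fun_le _ (R * R)%type R setT fst snd.
  by rewrite setTI; apply.
have mK : measurable_fun setT (kernel a b p k).
  apply: measurable_funM; last exact: measurable_indic.
  apply: measurable_funM.
    by apply: measurableT_comp => //; exact: measurable_fst.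
  by apply: measurableT_comp => //; exact: measurable_snd.
apply/integrable12ltyP; first exact/measurable_EFinP.
have mak : measurable_fun setT (fun y => `|(k \_ `[a, b]) y|%:E).
  by apply/measurable_EFinP; exact: measurableT_comp.
have map : measurable_fun setT (fun y => `|(p \_ `[a, b]) y|%:E).
  by apply/measurable_EFinP; exact: measurableT_comp.
have Ik0 : (0 <= \int[mu]_y `|(k \_ `[a, b]) y|%:E)%E.
  by apply: integral_ge0 => y _; rewrite lee_fin.
(* The indicator is at most [1], so the iterated integral of the modulus is at most the product of
   the [L^1] norms of [p] and [k]. *)
apply: (@le_lt_trans _ _ (\int[mu]_x (`|(p \_ `[a, b]) x|%:E *
   \int[mu]_y `|(k \_ `[a, b]) y|%:E))%E).
  apply: ge0_le_integral => //.
  - by move=> x _; exact: integral_ge0.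
  - have mN : measurable_fun setT (fun z => `|(EFin \o kernel a b p k) z|)%E.
      by apply/measurable_EFinP; exact: measurableT_comp.
    exact: (@measurable_fun_fubini_tonelli_F _ _ _ _ _ mu _ mN).
  - by apply: emeasurable_funM.
  - move=> x _; rewrite -ge0_integralZl//.
    apply: ge0_le_integral => //.
    + apply/measurable_EFinP; apply: measurableT_comp => //.
      exact: (measurableT_comp mK).
    + by apply: emeasurable_funM.
    + move=> y _ /=; rewrite lee_fin /kernel/= !normrM -[leRHS]mulr1.
      apply: ler_wpM2l; first by rewrite mulr_ge0.
      by rewrite indicE; case: (_ \in _); rewrite ?normr1// normr0.
move/integrableP : Ik => [_ /= ltk]; move/integrableP : Ip => [_ /= ltp].
(* The norm of [k] is finite, hence a real constant that can be pulled out of the outer integral. *)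
have -> : (\int[mu]_y `|(k \_ `[a, b]) y|%:E =
    (fine (\int[mu]_y `|(k \_ `[a, b]) y|%:E))%:E)%E.
  by rewrite fineK// ge0_fin_numE.
rewrite ge0_integralZr ?lee_fin ?fine_ge0//.
by rewrite muleC lte_mul_pinfty// lee_fin fine_ge0.
Qed.

Let kernel_int1 a b p k s :
  mu.-integrable `[a, b] (EFin \o k) ->
  (\int[mu]_r (kernel a b p k (s, r))%:E =
   (((fun s => p s * \int[mu]_(r in `[s, b]) k r) \_ `[a, b]) s)%:E)%E.
Proof.
move=> ik; rewrite patchE; case: ifPn => [|]; rewrite ?inE ?notin_setE/= => sab.
  have iks : mu.-integrable `[s, b] (EFin \o k).
    apply: integrableS ik => //; apply: subset_itvr.
    by move: sab; rewrite in_itv/= bnd_simp => /andP[].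
  under eq_integral do rewrite (kernel_section1 _ _ _ _ _ _ sab) EFinM.
  rewrite integralZl//; last first.
    exact: integrable_patch_itv.
  rewrite EFinM; congr (_ * _)%E; rewrite /Rintegral fineK ?integrable_fin_num//.
  by rewrite [RHS]integral_mkcond restrict_EFin.
by apply: integral0_eq => r _; rewrite /kernel /= patchE memNset// !mul0r.
Qed.

Let kernel_int2 a b p k r :
  mu.-integrable `[a, b] (EFin \o p) ->
  (\int[mu]_s (kernel a b p k (s, r))%:E =
   (((fun r => k r * \int[mu]_(s in `[a, r]) p s) \_ `[a, b]) r)%:E)%E.
Proof.
move=> ip; rewrite patchE; case: ifPn => [|]; rewrite ?inE ?notin_setE/= => rab.
  have ips : mu.-integrable `[a, r] (EFin \o p).
    apply: integrableS ip => //; apply: subset_itvl.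
    by move: rab; rewrite in_itv/= bnd_simp => /andP[].
  under eq_integral do rewrite (kernel_section2 _ _ _ _ _ _ rab) EFinM.
  rewrite integralZl//; last first.
    exact: integrable_patch_itv.
  rewrite EFinM; congr (_ * _)%E; rewrite /Rintegral fineK ?integrable_fin_num//.
  by rewrite [RHS]integral_mkcond restrict_EFin.
apply: integral0_eq => s _; rewrite /kernel /= [X in _ * X * _]patchE memNset//.
by rewrite mulr0 mul0r.
Qed.

(** Both sides are iterated integrals of [kernel] over the plane. When [p] is a derivative, this
    exchange does the work of an integration by parts. *)
Lemma Rintegral_triangle a b p k :
  mu.-integrable `[a, b] (EFin \o p) -> mu.-integrable `[a, b] (EFin \o k) ->
  \int[mu]_(s in `[a, b]) (p s * \int[mu]_(r in `[s, b]) k r) =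
  \int[mu]_(r in `[a, b]) (k r * \int[mu]_(s in `[a, r]) p s).
Proof.
move=> ip ik; rewrite Rintegral_mkcond [RHS]Rintegral_mkcond /Rintegral.
congr fine.
transitivity (\int[mu]_s \int[mu]_r (EFin \o kernel a b p k) (s, r))%E.
  by apply: eq_integral => s _; rewrite [RHS]kernel_int1.
rewrite (Fubini (kernel_integrable _ _ _ _ ip ik)).
by apply: eq_integral => r _; rewrite [LHS]kernel_int2.
Qed.

(** Fubini's theorem also yields integrability of the inner integral, so the regularity of the
    primitive of [k] need not be studied. *)
Lemma integrable_triangle a b p k :
  mu.-integrable `[a, b] (EFin \o p) -> mu.-integrable `[a, b] (EFin \o k) ->
  mu.-integrable `[a, b] (EFin \o (fun s => p s * \int[mu]_(r in `[s, b]) k r)).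
Proof.
move=> ip ik; apply: (integrable_mkcond _ _).2 => //; rewrite restrict_EFin.
have := integrable_fubini_F (kernel_integrable _ _ _ _ ip ik).
rewrite /fubini_F; apply: eq_integrable => // s _ /=.
by rewrite [LHS]kernel_int1.
Qed.

End triangle.

(** * Real integrals on intervals: exponential weights, integration by parts, comparison almost
    everywhere *)

Section real_integrals.
Context {R : realType}.
Notation mu := (@lebesgue_measure R).
Implicit Types (a b m t : R) (D : set R) (f g k l : R -> R).

Lemma integrable_funD D f g : measurable D ->
  mu.-integrable D (EFin \o f) -> mu.-integrable D (EFin \o g) ->
  mu.-integrable D (EFin \o (fun x => f x + g x)).
Proof. by move=> mD; exact: integrableD. Qed.

Lemma integrable_funB D f g : measurable D ->
  mu.-integrable D (EFin \o f) -> mu.-integrable D (EFin \o g) ->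
  mu.-integrable D (EFin \o (fun x => f x - g x)).
Proof. by move=> mD; exact: integrableB. Qed.

Lemma integrable_funZ D r f : measurable D ->
  mu.-integrable D (EFin \o f) -> mu.-integrable D (EFin \o (fun x => r * f x)).
Proof. by move=> mD; exact: integrableZl. Qed.

Lemma integrable_sub_itv {a b a' b' f} : a <= a' -> b' <= b ->
  mu.-integrable `[a, b] (EFin \o f) -> mu.-integrable `[a', b'] (EFin \o f).
Proof.
move=> aa bb; apply: integrableS => //.
by apply: subset_itv; rewrite bnd_simp.
Qed.

Lemma integrable_continuousM a b f k : continuous f ->
  mu.-integrable `[a, b] (EFin \o k) ->
  mu.-integrable `[a, b] (EFin \o (fun t => f t * k t)).
Proof.
move=> cf ik; apply: (@integrableMr _ _ _ mu `[a, b] _ f (EFin \o k)) => //.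
  by apply: measurable_funTS; exact: continuous_measurable_fun.
have : compact (f @` `[a, b]).
  apply: continuous_compact; last exact: segment_compact.
  exact: continuous_subspaceT.
move=> /compact_bounded [M [Mr MM]]; exists M; split => // x Mx y aby.
by apply: MM => //; exists y.
Qed.

Lemma continuous_expRM m : continuous (fun t : R => expR (m * t)).
Proof.
move=> t; apply: (@continuous_comp _ _ _ (fun t => m * t) expR); last exact: continuous_expR.
exact: mulrl_continuous.
Qed.

Lemma integrable_expRM a b m k : mu.-integrable `[a, b] (EFin \o k) ->
  mu.-integrable `[a, b] (EFin \o (fun t => expR (m * t) * k t)).
Proof. by apply: integrable_continuousM; exact: continuous_expRM. Qed.

Lemma integrable_itv_continuous a b f : continuous f ->
  mu.-integrable `[a, b] (EFin \o f).
Proof.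
move=> cf; apply: continuous_compact_integrable; first exact: segment_compact.
exact: continuous_subspaceT.
Qed.

Lemma Rintegral_expRM m a b : a <= b ->
  \int[mu]_(s in `[a, b]) (m * expR (m * s)) = expR (m * b) - expR (m * a).
Proof.
(* The fundamental theorem of calculus is applied for [a < b]; the one-point interval is treated
   apart. *)
rewrite le_eqVlt => /predU1P[<-|ab].
  by rewrite set_itv1 Rintegral_set1 subrr.
have dF (x : R) : is_derive x (1 : R) (fun s : R => expR (m * s)) (m * expR (m * x)).
  apply: is_derive_eq.
  by rewrite /GRing.scale/= mulr1 mulrC.
rewrite /Rintegral (@continuous_FTC2 _ _ (fun s => expR (m * s)))//.
- apply: continuous_subspaceT => x; apply: cvgM; first exact: cvg_cst.
  exact: continuous_expRM.
- split=> [x _| |].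
  + exact: ex_derive.
  + by apply: cvg_at_right_filter; exact: continuous_expRM.
  + by apply: cvg_at_left_filter; exact: continuous_expRM.
- by move=> x _; rewrite derive1E; exact: derive_val.
Qed.

Lemma Rintegral_split a b t f : a <= t <= b ->
  mu.-integrable `[a, b] (EFin \o f) ->
  \int[mu]_(s in `[a, b]) f s =
  \int[mu]_(s in `[a, t]) f s + \int[mu]_(s in `[t, b]) f s.
Proof.
move=> /andP[at_ tb] itf.
have := @Rintegral_itvB _ f (BLeft a) (BRight b) t itf; rewrite !bnd_simp.
move=> /(_ at_ tb) /eqP; rewrite subr_eq addrC => /eqP ->; congr (_ + _).
apply: Rintegral_itv_obnd_cbnd; apply: integrableS itf => //.
by apply: subset_itv; rewrite bnd_simp.
Qed.

(** Integration by parts against the primitive of [l], obtained by exchanging the order of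
    integration: the inner integral of [m * expR (m * s)] over [[a, r]] is explicit. No absolutely
    continuous function has to be differentiated. *)
Lemma Rintegral_expRM_primitive m a b l : a <= b ->
  mu.-integrable `[a, b] (EFin \o l) ->
  \int[mu]_(s in `[a, b]) (m * expR (m * s) * \int[mu]_(r in `[s, b]) l r) =
  \int[mu]_(r in `[a, b]) (expR (m * r) * l r) -
  expR (m * a) * \int[mu]_(r in `[a, b]) l r.
Proof.
move=> ab il; rewrite Rintegral_triangle//; last first.
  apply: integrable_itv_continuous => x; apply: cvgM; first exact: cvg_cst.
  exact: continuous_expRM.
rewrite -RintegralZl// -RintegralB//; last 2 first.
- exact: integrable_expRM.
- exact: integrable_funZ.
apply: eq_Rintegral => r; rewrite inE/= in_itv/= => /andP[ar rb].
by rewrite Rintegral_expRM//; ring.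
Qed.

(** Lets [filterS], [filterS2] and [filterE] combine almost-everywhere statements for [mu]. *)
#[export] Instance lebesgue_ae_filter : Filter (almost_everywhere mu).
Proof. exact: (@ae_filter_ringOfSetsType _ (measurableTypeR R) R mu). Qed.

Lemma ae_eq_Rintegral D f g : measurable D ->
  mu.-integrable D (EFin \o f) -> mu.-integrable D (EFin \o g) ->
  {ae mu, forall t, D t -> f t = g t} ->
  \int[mu]_(t in D) f t = \int[mu]_(t in D) g t.
Proof.
move=> mD If Ig fg; congr fine; apply: ae_eq_integral => //.
- exact: measurable_int If.
- exact: measurable_int Ig.
- by apply: filterS fg => t /= h /h ->.
Qed.

(** Almost everywhere on [D], [f] agrees with its modulus, whose integral is nonnegative. *)
Lemma ae_ge0_Rintegral D f : measurable D -> mu.-integrable D (EFin \o f) ->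
  {ae mu, forall t, D t -> 0 <= f t} -> 0 <= \int[mu]_(t in D) f t.
Proof.
move=> mD If f0; rewrite (_ : \int[mu]_(t in D) f t = \int[mu]_(t in D) `|f t|).
  exact: Rintegral_ge0.
apply: ae_eq_Rintegral => //; first exact: integrable_norm.
by apply: filterS f0 => t /= h Dt; rewrite ger0_norm// h.
Qed.

Lemma ae_le_Rintegral D f g : measurable D ->
  mu.-integrable D (EFin \o f) -> mu.-integrable D (EFin \o g) ->
  {ae mu, forall t, D t -> f t <= g t} ->
  \int[mu]_(t in D) f t <= \int[mu]_(t in D) g t.
Proof.
move=> mD If Ig fg; rewrite -subr_ge0 -RintegralB//.
apply: ae_ge0_Rintegral => //; first exact: integrable_funB.
by apply: filterS fg => t /= h Dt; rewrite subr_ge0 h.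
Qed.

End real_integrals.

(** * Reduction of the real resolvent equation to a scalar equation *)

Section delay_equation.
Context {R : realType}.
Notation mu := (@lebesgue_measure R).
Implicit Types (c m x y t : R) (f g k : R -> R).

Lemma aeIE (P : R -> Prop) :
  aeI P <-> {ae mu, forall t, `[-2, 0]%classic t -> P t}.
Proof.
rewrite /aeI /almost_everywhere /=; suff -> : [set t | I02 t /\ ~ P t] =
  ~` [set t | `[-2, 0]%classic t -> P t] by [].
by apply/seteqP; split => t /= /not_implyP.
Qed.

(** Variation of constants for [f' = m f - k], solved backwards from the value [x] at [0]. *)
Definition trajectory m x k t : R :=
  expR (m * t) * (x + \int[mu]_(s in `[t, 0]) (expR (- m * s) * k s)).

Lemma integrable_trajectory m x k : mu.-integrable `[-2, 0] (EFin \o k) ->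
  mu.-integrable `[-2, 0] (EFin \o trajectory m x k).
Proof.
move=> ik; have e := integrable_expRM _ _ (- m) _ ik.
have i1 : mu.-integrable `[(-2 : R), 0] (EFin \o (fun s => expR (m * s))).
  by apply: integrable_itv_continuous; exact: continuous_expRM.
have i2 := integrable_funD _ _ _ (measurable_itv _)
  (integrable_funZ _ x _ (measurable_itv _) i1)
  (integrable_triangle _ _ _ _ i1 e).
apply: eq_integrable i2 => // t _ /=.
by rewrite /trajectory; congr EFin; ring.
Qed.

(** Write [F t] for [x - \int_t^0 g]. Substituting [k = m F - g] into the formula for [trajectory]
    and integrating by parts once, with the exponent [- m], leaves exactly [F t]. *)
Lemma trajectory_unique m x g k :
  mu.-integrable `[-2, 0] (EFin \o g) -> mu.-integrable `[-2, 0] (EFin \o k) ->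
  {ae mu, forall t, `[-2, 0]%classic t ->
    m * (x - \int[mu]_(s in `[t, 0]) g s) - g t = k t} ->
  forall t, t \in `[-2, 0] -> x - \int[mu]_(s in `[t, 0]) g s = trajectory m x k t.
Proof.
move=> ig ik gk t; rewrite in_itv/= => /andP[t2 t0].
have igt := integrable_sub_itv t2 (lexx 0) ig.
have ikt := integrable_sub_itv t2 (lexx 0) ik.
have i1 : mu.-integrable `[t, 0] (EFin \o (fun s => - m * expR (- m * s))).
  apply: integrable_funZ => //.
  by apply: integrable_itv_continuous; exact: continuous_expRM.
have i2 := integrable_triangle _ _ _ _ i1 igt.
have i3 := integrable_expRM _ _ (- m) _ igt.
have i4 := integrable_funB _ _ _ (measurable_itv _) i2 i3.
have i5 := integrable_funZ _ (- x) _ (measurable_itv _) i1.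
rewrite /trajectory.
rewrite (@ae_eq_Rintegral _ `[t, 0] (fun s => expR (- m * s) * k s)
    (fun s => - x * (- m * expR (- m * s)) +
      (- m * expR (- m * s) * \int[mu]_(r in `[s, 0]) g r -
       expR (- m * s) * g s)))//; last 3 first.
- exact: integrable_expRM.
- exact: integrable_funD.
- apply: filterS gk => s h /=; rewrite in_itv/= => /andP[ts s0].
  rewrite -h /= ?in_itv/= ?s0 ?(le_trans t2)//; ring.
rewrite RintegralD// RintegralB// RintegralZl// Rintegral_expRM//.
rewrite Rintegral_expRM_primitive// mulr0 expR0 (mulNr m t) expRN.
by field; rewrite gt_eqF// expR_gt0.
Qed.

(** The same integration by parts with the exponent [m]; the two exponentials then cancel in front
    of [k]. *)
Lemma trajectory_solves m x k t : mu.-integrable `[-2, 0] (EFin \o k) ->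
  t \in `[-2, 0] ->
  x - \int[mu]_(s in `[t, 0]) (m * trajectory m x k s - k s) = trajectory m x k t.
Proof.
move=> ik; rewrite in_itv/= => /andP[t2 t0].
have ikt := integrable_sub_itv t2 (lexx 0) ik.
have i1 : mu.-integrable `[t, 0] (EFin \o (fun s => m * expR (m * s))).
  apply: integrable_funZ => //.
  by apply: integrable_itv_continuous; exact: continuous_expRM.
have il := integrable_expRM _ _ (- m) _ ikt.
have i2 := integrable_triangle _ _ _ _ i1 il.
have i4 := integrable_funB _ _ _ (measurable_itv _) i2 ikt.
have i5 := integrable_funZ _ x _ (measurable_itv _) i1.
have -> : \int[mu]_(s in `[t, 0]) (m * trajectory m x k s - k s) =
    \int[mu]_(s in `[t, 0]) (x * (m * expR (m * s)) +
      (m * expR (m * s) * \int[mu]_(r in `[s, 0]) (expR (- m * r) * k r) - k s)).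
  by apply: eq_Rintegral => s _; rewrite /trajectory; ring.
rewrite RintegralD// RintegralB// RintegralZl// Rintegral_expRM//.
rewrite Rintegral_expRM_primitive//.
have -> : \int[mu]_(r in `[t, 0]) (expR (m * r) * (expR (- m * r) * k r)) =
    \int[mu]_(r in `[t, 0]) k r.
  by apply: eq_Rintegral => s _; rewrite mulrA -expRD mulNr subrr expR0 mul1r.
by rewrite /trajectory mulr0 expR0; ring.
Qed.

(* The real form of [(m - A)(x, f) = (y, k)], with [g] the weak derivative of [f]. *)
Definition real_res c m y k x f := exists g,
  [/\ mu.-integrable `[-2, 0] (EFin \o f) /\ mu.-integrable `[-2, 0] (EFin \o g),
      aeI (fun t => f t = x - \int[mu]_(s in `[t, 0]) g s),
      m * x - c * (\int[mu]_(s in `[-2, -1]) f s - \int[mu]_(s in `[-1, 0]) f s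
                   - \int[mu]_(s in `[-2, 0]) g s) = y &
      aeI (fun t => m * f t - g t = k t)].

(** This is [m] times the characteristic function [m - Phi(e^(m .))] of [A], with the integrals of
    the exponential evaluated. *)
Definition charP c m : R :=
  m ^+ 2 + c * (1 - expR (- m)) ^+ 2 + c * m * (1 - expR (- m) ^+ 2).

(* Both summands are integrals of [k] against a weight; see [forcingE]. *)
Definition forcing m k : R :=
  (\int[mu]_(s in `[-2, -1]) k s -
   (1 - m) * expR (- m) ^+ 2 * \int[mu]_(s in `[-2, -1]) (expR (- m * s) * k s)) +
  ((2 - (1 - m) * expR (- m)) * expR (- m) *
     \int[mu]_(s in `[-1, 0]) (expR (- m * s) * k s) -
   \int[mu]_(s in `[-1, 0]) k s).

(** Multiplying the boundary equation by [m] is reversible because [m <> 0], and it is what allows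
    the integrals of [f] to be eliminated. Existence, uniqueness, bounds and signs are all read off
    from the form on the right. *)
Lemma real_resP c m y k x f : m != 0 -> mu.-integrable `[-2, 0] (EFin \o k) ->
  real_res c m y k x f <->
  [/\ mu.-integrable `[-2, 0] (EFin \o f), aeI (fun t => f t = trajectory m x k t) &
      charP c m * x = m * y + c * forcing m k].
Proof.
move=> m0 ik.
have le21 : (-2 : R) <= -1 by lra.
have le10 : (-1 : R) <= 0 by lra.
have le12 : ((-2 : R) <= -1) && ((-1 : R) <= 0) by rewrite le21 le10.
have in2 : (-2 : R) \in `[-2, 0] by rewrite in_itv/= lexx (le_trans le21).
have in1 : (-1 : R) \in `[-2, 0] by rewrite in_itv/= le21.
(* Integrating [g = m f - k] over the two halves removes the integrals of [f]. *)
suff key g : mu.-integrable `[-2, 0] (EFin \o f) ->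
    mu.-integrable `[-2, 0] (EFin \o g) ->
    aeI (fun t => m * f t - g t = k t) ->
    (forall t, t \in `[-2, 0] ->
      x - \int[mu]_(s in `[t, 0]) g s = trajectory m x k t) ->
    m * (m * x - c * (\int[mu]_(s in `[-2, -1]) f s -
      \int[mu]_(s in `[-1, 0]) f s - \int[mu]_(s in `[-2, 0]) g s)) =
    charP c m * x - c * forcing m k.
  split=> [[g [[iF ig] fg xy fk]]|[iF fo Px]].
    have go : forall t, t \in `[-2, 0] ->
        x - \int[mu]_(s in `[t, 0]) g s = trajectory m x k t.
      apply: trajectory_unique => //; move: fg fk => /aeIE + /aeIE; apply: filterS2.
      by move=> t /= fg fk t20; rewrite -fg// fk.
    split => //; last by have := key _ iF ig fk go; rewrite xy => ->; ring.
    move/aeIE : fg => fg; apply/aeIE; apply: filterS fg => t h t20.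
    by rewrite h// go.
  have fE := fo; move/aeIE : fE => fE.
  (* The equation itself dictates the weak derivative. *)
  pose g s := m * f s - k s.
  have ig : mu.-integrable `[-2, 0] (EFin \o g).
    by apply: integrable_funB => //; exact: integrable_funZ.
  have go t : t \in `[-2, 0] ->
      x - \int[mu]_(s in `[t, 0]) g s = trajectory m x k t.
    move=> t20; rewrite -trajectory_solves//.
    congr (_ - _); have tm2 : -2 <= t by move: t20; rewrite in_itv/= => /andP[].
    have io := integrable_trajectory m x _ ik.
    apply: ae_eq_Rintegral => //.
    - exact: integrable_sub_itv ig.
    - apply: (integrable_sub_itv tm2 (lexx 0)); apply: integrable_funB => //.
      exact: integrable_funZ.
    - apply: filterS fE => s h /=; rewrite in_itv/= => /andP[ts s0].
      by rewrite /g h//= in_itv/= s0 (le_trans tm2).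
  have fk : aeI (fun t => m * f t - g t = k t).
    by apply/aeIE; apply: filterE => t _; rewrite /g; ring.
  exists g; split => //.
    by apply/aeIE; apply: filterS fE => t h t20; rewrite h// go.
  apply: (mulfI m0); rewrite key// Px; ring.
move=> iF ig /aeIE fk go.
have half a b : -2 <= a -> b <= 0 -> m * \int[mu]_(s in `[a, b]) f s =
    \int[mu]_(s in `[a, b]) g s + \int[mu]_(s in `[a, b]) k s.
  move=> a2 b0; have iF' := integrable_sub_itv a2 b0 iF.
  have ig' := integrable_sub_itv a2 b0 ig.
  have ik' := integrable_sub_itv a2 b0 ik.
  rewrite -RintegralZl// -RintegralD//; apply: ae_eq_Rintegral => //.
  - exact: integrable_funZ.
  - exact: integrable_funD.
  - apply: filterS fk => s h /=; rewrite in_itv/= => /andP[as_ sb].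
    rewrite -h /= ?in_itv/= ?(le_trans sb)// ?andbT ?(le_trans a2)//; ring.
have e := integrable_expRM _ _ (- m) _ ik.
(* The values of the trajectory at [-1] and [-2] express the integrals of [g] over the two halves
   through [x] and the weighted integrals of [k]. *)
have := go _ in2; have := go _ in1.
rewrite /trajectory (Rintegral_split _ _ _ _ le12 ig) (Rintegral_split _ _ _ _ le12 e).
have -> : m * -2 = - m + - m by ring.
rewrite mulrN1 expRD.
have := half (-2) (-1) (lexx _) le10; have := half (-1) 0 le21 (lexx _).
rewrite /charP /forcing; set q := expR (- m).
set f1 := \int[mu]_(s in `[-2, -1]) f s; set f2 := \int[mu]_(s in `[-1, 0]) f s.
set g1 := \int[mu]_(s in `[-2, -1]) g s; set g2 := \int[mu]_(s in `[-1, 0]) g s.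
set k1 := \int[mu]_(s in `[-2, -1]) k s; set k2 := \int[mu]_(s in `[-1, 0]) k s.
set l1 := \int[mu]_(s in `[-2, -1]) _; set l2 := \int[mu]_(s in `[-1, 0]) _.
move=> h2 h1 e1 e2.
have -> : m * (m * x - c * (f1 - f2 - (g1 + g2))) =
  m ^+ 2 * x - c * (m * f1 - m * f2 - m * (g1 + g2)) by ring.
rewrite h1 h2.
have -> : g2 = x - q * (x + l2) by rewrite -e1; ring.
have -> : g1 = q * (x + l2) - q * q * (x + (l1 + l2)) by rewrite -e1 -e2; ring.
ring.
Qed.

End delay_equation.

(** * Lower bound for [charP] and one-sided estimates of the forcing term *)

Section estimates.
Context {R : realType}.
Notation mu := (@lebesgue_measure R).
Implicit Types (c m x y t : R) (f g k : R -> R).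

(** The other two terms are nonnegative: [m] and [1 - expR (- m) ^+ 2] have the same sign. *)
Lemma charP_ge c m : 0 < c -> m ^+ 2 <= charP c m.
Proof.
move=> c0; have q0 := expR_gt0 (- m).
have mq : 0 <= m * (1 - expR (- m) ^+ 2).
  have [m0|m0] := leP 0 m.
    have : expR (- m) <= 1 by rewrite -expR0 ler_expR; lra.
    by move=> q1; apply: mulr_ge0 => //; nra.
  have : 1 <= expR (- m) by rewrite -expR0 ler_expR; lra.
  by move=> q1; apply: mulr_le0; nra.
rewrite /charP -addrA lerDl -mulrA -mulrDr; apply: mulr_ge0; first exact: ltW.
by apply: addr_ge0 => //; exact: sqr_ge0.
Qed.

Lemma charP_gt0 c m : 0 < c -> m != 0 -> 0 < charP c m.
Proof.
move=> c0 m0; apply: lt_le_trans (charP_ge c m c0).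
by rewrite exprn_even_gt0.
Qed.

Lemma expRN_sqrM m t : expR (- m) ^+ 2 * expR (- m * t) = expR (- m * (t + 2)).
Proof. by rewrite expr2 -!expRD; congr expR; ring. Qed.

Lemma expRNM m t : expR (- m) * expR (- m * t) = expR (- m * (t + 1)).
Proof. by rewrite -expRD; congr expR; ring. Qed.

(** Moves the constants of [forcing] under the integrals, which shifts each exponent to the left
    endpoint of its half. With the trial bound [r] subtracted, an estimate of [forcing] becomes a
    pointwise sign condition on two weights. *)
Lemma forcingE m r k : mu.-integrable `[-2, 0] (EFin \o k) ->
  forcing m k - r * \int[mu]_(s in `[-2, 0]) k s =
  \int[mu]_(s in `[-2, -1])
    ((1 - (1 - m) * expR (- m * (s + 2)) - r) * k s) +
  \int[mu]_(s in `[-1, 0])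
    (((2 - (1 - m) * expR (- m)) * expR (- m * (s + 1)) - 1 - r) * k s).
Proof.
move=> ik.
have le21 : (-2 : R) <= -1 by lra.
have le10 : (-1 : R) <= 0 by lra.
have ik1 := integrable_sub_itv (lexx _) le10 ik.
have ik2 := integrable_sub_itv le21 (lexx _) ik.
have e1 := integrable_expRM _ _ (- m) _ ik1.
have e2 := integrable_expRM _ _ (- m) _ ik2.
rewrite (@Rintegral_split _ (-2) 0 (-1))// ?le21//.
have -> : \int[mu]_(s in `[-2, -1])
    ((1 - (1 - m) * expR (- m * (s + 2)) - r) * k s) =
  (1 - r) * \int[mu]_(s in `[-2, -1]) k s - (1 - m) * expR (- m) ^+ 2 *
     \int[mu]_(s in `[-2, -1]) (expR (- m * s) * k s).
  rewrite -!RintegralZl// -RintegralB//; last 2 first.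
  - exact: integrable_funZ.
  - exact: integrable_funZ.
  by apply: eq_Rintegral => s _; rewrite -expRN_sqrM; ring.
have -> : \int[mu]_(s in `[-1, 0])
    (((2 - (1 - m) * expR (- m)) * expR (- m * (s + 1)) - 1 - r) * k s) =
  (2 - (1 - m) * expR (- m)) * expR (- m) *
     \int[mu]_(s in `[-1, 0]) (expR (- m * s) * k s) -
  (1 + r) * \int[mu]_(s in `[-1, 0]) k s.
  rewrite -!RintegralZl// -RintegralB//; last 2 first.
  - exact: integrable_funZ.
  - exact: integrable_funZ.
  by apply: eq_Rintegral => s _; rewrite -expRNM; ring.
rewrite /forcing; ring.
Qed.

Lemma integrable_forcing_weights m r k :
  mu.-integrable `[-2, 0] (EFin \o k) ->
  mu.-integrable `[-2, -1] (EFin \o (fun s =>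
    (1 - (1 - m) * expR (- m * (s + 2)) - r) * k s)) /\
  mu.-integrable `[-1, 0] (EFin \o (fun s =>
    ((2 - (1 - m) * expR (- m)) * expR (- m * (s + 1)) - 1 - r) * k s)).
Proof.
move=> ik.
have le21 : (-2 : R) <= -1 by lra.
have le10 : (-1 : R) <= 0 by lra.
have ce d : continuous (fun s : R => expR (- m * (s + d))).
  move=> s; apply: (@continuous_comp _ _ _ (fun s => s + d) (fun t => expR (- m * t))).
    by apply: cvgD; [exact: cvg_id|exact: cvg_cst].
  exact: continuous_expRM.
split; apply: integrable_continuousM.
- move=> s; apply: cvgB; last exact: cvg_cst.
  apply: cvgB; first exact: cvg_cst.
  by apply: cvgM; [exact: cvg_cst|exact: ce].
- exact: integrable_sub_itv ik.
- move=> s; apply: cvgB; last exact: cvg_cst.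
  apply: cvgB; last exact: cvg_cst.
  by apply: cvgM; [exact: cvg_cst|exact: ce].
- exact: integrable_sub_itv ik.
Qed.

(** On [[-2, -1]] the exponential is at most [1], so the weight minus [m / 2] is at least [m / 2].
    On [[-1, 0]] the exponential is smallest at [s = 0]; there, with [q = expR (- m)], the weight
    minus [m / 2] is [m * q ^+ 2 - (1 - q) ^+ 2 - m / 2]. *)
Lemma forcing_ge m k : 0 < m < 6^-1 -> mu.-integrable `[-2, 0] (EFin \o k) ->
  aeI (fun t => 0 <= k t) ->
  m / 2 * \int[mu]_(s in `[-2, 0]) k s <= forcing m k.
Proof.
move=> /andP[m0 m6] ik /aeIE k0; rewrite -subr_ge0 forcingE//.
have [i1 i2] := integrable_forcing_weights m (m / 2) _ ik.
have q0 : 0 < expR (- m) := expR_gt0 _.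
have q1 : 1 - m <= expR (- m) := expR_ge1Dx _.
have q2 : expR (- m) <= 1 by rewrite -expR0 ler_expR; lra.
apply: addr_ge0; apply: ae_ge0_Rintegral => //;
  apply: filterS k0 => s h /=; rewrite in_itv/= => /andP[s1 s2];
  (apply: mulr_ge0; last by apply: h; rewrite /= in_itv/=; apply/andP; split; lra).
  have : expR (- m * (s + 2)) <= 1.
    by rewrite -[leRHS]expR0 ler_expR mulNr oppr_le0 mulr_ge0//; lra.
  move: (expR _) => E E1.
  have : (1 - m) * E <= (1 - m) * 1 by apply: ler_wpM2l => //; lra.
  by move: ((1 - m) * E) => Z; lra.
have : expR (- m) <= expR (- m * (s + 1)).
  by rewrite ler_expR mulNr lerN2 ler_piMr//; lra.
move: (expR (- m * (s + 1))) (expR (- m)) q0 q1 q2 => E q q0 q1 q2 qE.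
have : (2 - (1 - m) * q) * q <= (2 - (1 - m) * q) * E.
  apply: ler_wpM2l => //.
  have : (1 - m) * q <= 1 * 1 by apply: ler_pM; lra.
  by move: ((1 - m) * q) => Z; lra.
have : (1 - q) ^+ 2 <= m ^+ 2 by rewrite ler_sqr ?nnegrE; lra.
have : (1 - m) ^+ 2 <= q ^+ 2 by rewrite ler_sqr ?nnegrE; lra.
move: ((2 - (1 - m) * q) * E) => Z h1 h2 h3.
have h4 : m * (1 - m) ^+ 2 <= m * q ^+ 2 by rewrite ler_pM2l.
(* By [1 - m <= q <= 1] this is a lower bound for the weight minus [m / 2]; [m < 6^-1] is what makes
   [2^-1 - 3 * m] positive. *)
have h5 : 0 <= m * (2^-1 - 3 * m + m ^+ 2).
  by apply: mulr_ge0; [exact: ltW|have := sqr_ge0 m; lra].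
lra.
Qed.

(** The same two weights with all inequalities reversed: the exponential is at least [1] on
    [[-2, -1]] and at most [expR (- m)] on [[-1, 0]]. *)
Lemma forcing_le m k : -1 < m < 0 -> mu.-integrable `[-2, 0] (EFin \o k) ->
  aeI (fun t => 0 <= k t) ->
  forcing m k <= m / 2 * \int[mu]_(s in `[-2, 0]) k s.
Proof.
move=> /andP[m1 m0] ik /aeIE k0; rewrite -subr_le0 forcingE//.
have [i1 i2] := integrable_forcing_weights m (m / 2) _ ik.
have q1 : 1 <= expR (- m) by rewrite -expR0 ler_expR; lra.
rewrite -oppr_ge0 opprD -![- Rintegral _ _ _]mulN1r -!RintegralZl//.
apply: addr_ge0; (apply: ae_ge0_Rintegral => //; first exact: integrable_funZ);
  apply: filterS k0 => s h /=; rewrite in_itv/= => /andP[s1 s2];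
  rewrite mulrA;
  (apply: mulr_ge0; last by apply: h; rewrite /= in_itv/=; apply/andP; split; lra).
  have : 1 <= expR (- m * (s + 2)).
    by rewrite -[leLHS]expR0 ler_expR mulr_ge0//; lra.
  move: (expR _) => E E1.
  have : (1 - m) * 1 <= (1 - m) * E by apply: ler_wpM2l => //; lra.
  by move: ((1 - m) * E) => Z; lra.
have : expR (- m * (s + 1)) <= expR (- m).
  by rewrite ler_expR ler_piMr//; lra.
have : 0 < expR (- m * (s + 1)) := expR_gt0 _.
move: (expR (- m * (s + 1))) (expR (- m)) q1 => E q q1 E0 qE.
(* This coefficient changes sign for [m] between [-1] and [0]. Where it is nonpositive, the weight
   minus [m / 2] is at most [- 1 - m / 2]; otherwise the exponential may be replaced by its maximum
   [q]. *)
have [C0|C0] := leP (2 - (1 - m) * q) 0.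
  have : (2 - (1 - m) * q) * E <= 0 by rewrite mulr_le0_ge0// ltW.
  move: ((2 - (1 - m) * q) * E) => Z; lra.
have : (2 - (1 - m) * q) * E <= (2 - (1 - m) * q) * q.
  by apply: ler_wpM2l => //; rewrite ltW.
move: ((2 - (1 - m) * q) * E) => Z h3.
have h1 := sqr_ge0 (1 - q).
have h2 : m * q ^+ 2 <= m * 1.
  by rewrite ler_nM2l// expr_ge1// (le_trans ler01).
lra.
Qed.

End estimates.

(** * The real resolvent: solvability, boundedness, and one-sided bounds for nonnegative data *)

Section real_resolvent.
Context {R : realType}.
Notation mu := (@lebesgue_measure R).
Implicit Types (a b c m x y t : R) (f g k : R -> R).

Lemma real_res_exists c m y k : 0 < c -> m != 0 ->
  mu.-integrable `[-2, 0] (EFin \o k) -> exists x f, real_res c m y k x f.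
Proof.
move=> c0 m0 ik; pose x := (charP c m)^-1 * (m * y + c * forcing m k).
exists x, (trajectory m x k); apply/real_resP => //; split.
- exact: integrable_trajectory.
- by apply/aeIE; exact: filterE.
- by rewrite mulrA divff ?mul1r// gt_eqF// charP_gt0.
Qed.

Lemma real_res_unique c m y k x1 x2 f1 f2 : 0 < c -> m != 0 ->
  mu.-integrable `[-2, 0] (EFin \o k) ->
  real_res c m y k x1 f1 -> real_res c m y k x2 f2 ->
  x1 = x2 /\ aeI (fun t => f1 t = f2 t).
Proof.
move=> c0 m0 ik /(real_resP _ _ _ _ _ _ m0 ik) [_ /aeIE f1E P1].
move=> /(real_resP _ _ _ _ _ _ m0 ik) [_ /aeIE f2E P2].
have x12 : x1 = x2.
  by apply: (mulfI (lt0r_neq0 (charP_gt0 _ _ c0 m0))); rewrite P1 P2.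
split=> //; apply/aeIE; apply: filterS2 f1E f2E => t h1 h2 t20.
by rewrite h1// h2// x12.
Qed.

Lemma Rintegral_sub_le a b k : -2 <= a -> a <= b -> b <= 0 ->
  mu.-integrable `[-2, 0] (EFin \o k) -> aeI (fun t => 0 <= k t) ->
  0 <= \int[mu]_(s in `[a, b]) k s <= \int[mu]_(s in `[-2, 0]) k s.
Proof.
move=> a2 ab b0 ik /aeIE k0.
have J0 a' b' : -2 <= a' -> b' <= 0 -> 0 <= \int[mu]_(s in `[a', b']) k s.
  move=> h1 h2; apply: ae_ge0_Rintegral => //.
    exact: integrable_sub_itv ik.
  apply: filterS k0 => s h /=; rewrite in_itv/= => /andP[s1 s2]; apply: h.
  by rewrite /= in_itv/= (le_trans h1)// (le_trans s2).
have a0 := le_trans ab b0.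
rewrite J0//= (@Rintegral_split _ (-2) 0 a) ?a2//.
rewrite (@Rintegral_split _ a 0 b) ?ab//; last exact: integrable_sub_itv ik.
have := J0 (-2) a (lexx _) a0; have := J0 b 0 (le_trans a2 ab) (lexx _).
by move=> h1 h2; rewrite addrCA lerDl addr_ge0.
Qed.

Lemma weighted_Rintegral_le a b (w : R -> R) k (W : R) : -2 <= a -> a <= b -> b <= 0 ->
  continuous w -> (forall s, s \in `[-2, 0] -> `|w s| <= W) ->
  mu.-integrable `[-2, 0] (EFin \o k) ->
  `|\int[mu]_(s in `[a, b]) (w s * k s)| <= W * \int[mu]_(s in `[-2, 0]) `|k s|.
Proof.
move=> a2 ab b0 cw wW ik.
have W0 : 0 <= W.
  apply: le_trans (wW 0 _); first exact: normr_ge0.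
  by rewrite in_itv/= lexx andbT (le_trans a2) ?(le_trans ab).
have ink := integrable_norm ik.
have ink' := integrable_sub_itv a2 b0 ink.
have iwk := integrable_continuousM _ _ _ _ cw (integrable_sub_itv a2 b0 ik).
apply: (le_trans (le_normr_Rintegral _ iwk)) => //.
apply: (@le_trans _ _ (W * \int[mu]_(s in `[a, b]) `|k s|)); last first.
  apply: ler_wpM2l => //.
  have k0 : aeI (fun t => 0 <= `|k t|) by apply/aeIE; apply: filterE => t _.
  by have /andP[_] := Rintegral_sub_le a b _ a2 ab b0 ink k0.
rewrite -RintegralZl//; apply: le_Rintegral => //.
- exact: integrable_norm iwk.
- exact: integrable_funZ.
- move=> s /=; rewrite in_itv/= => /andP[s1 s2]; rewrite normrM ler_wpM2r//.
  by apply: wW; rewrite in_itv/= (le_trans a2)// (le_trans s2).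
Qed.

Lemma expRM_le m t : t \in `[-2, 0] -> `|expR (m * t)| <= expR (2 * `|m|).
Proof.
rewrite in_itv/= => /andP[t2 t0]; rewrite ger0_norm ?expR_ge0// ler_expR.
apply: le_trans (ler_norm _) _; rewrite normrM mulrC ler_wpM2r//.
by rewrite ler_norml; apply/andP; split; lra.
Qed.

(** The bound on [f] is pointwise almost everywhere. It gives the norm estimate on [E] and also
    shows that zero data admit only the zero solution. *)
Lemma real_res_bound c m : 0 < c -> m != 0 -> exists K, 0 <= K /\
  forall y k x f, mu.-integrable `[-2, 0] (EFin \o k) ->
    real_res c m y k x f ->
    `|x| <= K * (`|y| + \int[mu]_(s in `[-2, 0]) `|k s|) /\
    aeI (fun t => `|f t| <= K * (`|y| + \int[mu]_(s in `[-2, 0]) `|k s|)).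
Proof.
move=> c0 m0.
have P0 := charP_gt0 _ _ c0 m0.
pose B := expR (2 * `|m|).
have B0 : 0 <= B by exact: expR_ge0.
(* [W] bounds [forcing]: the unweighted integrals contribute [2], and [B] bounds the exponential on
   [[-2, 0]]. Then [X] bounds [x] through the scalar equation. *)
pose W := 2 + `|(1 - m) * expR (- m) ^+ 2| * B
            + `|(2 - (1 - m) * expR (- m)) * expR (- m)| * B.
have W0 : 0 <= W by rewrite !addr_ge0// mulr_ge0.
pose X := (charP c m)^-1 * (`|m| + c * W).
have X0 : 0 <= X.
  rewrite mulr_ge0// ?invr_ge0 ?(ltW P0)// addr_ge0// mulr_ge0//.
  exact: ltW.
(* [X] serves for [x] and [B * (X + B)] for the trajectory, so the sum serves for both. *)
exists (X + B * (X + B)); split; first by rewrite addr_ge0// mulr_ge0// addr_ge0.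
move=> y k x f ik /(real_resP _ _ _ _ _ _ m0 ik) [_ /aeIE fE Px].
have le21 : (-2 : R) <= -1 by lra.
have le10 : (-1 : R) <= 0 by lra.
set I := \int[mu]_(s in `[-2, 0]) `|k s|.
have I0 : 0 <= I by exact: Rintegral_ge0.
have S0 : 0 <= `|y| + I by rewrite addr_ge0.
have be a b : -2 <= a -> a <= b -> b <= 0 ->
    `|\int[mu]_(s in `[a, b]) (expR (- m * s) * k s)| <= B * I.
  move=> ? ? ?; apply: weighted_Rintegral_le => //.
    exact: continuous_expRM.
  by move=> s s20; rewrite /B -[`|m|]normrN; exact: expRM_le.
have b1 a b : -2 <= a -> a <= b -> b <= 0 ->
    `|\int[mu]_(s in `[a, b]) k s| <= I.
  move=> a2 ab b0.
  have := @weighted_Rintegral_le a b (fun=> 1) k 1 a2 ab b0 _ _ ik.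
  under eq_Rintegral do rewrite mul1r.
  by rewrite mul1r; apply => [s|s _]; [exact: cvg_cst|rewrite normr1].
have Fb : `|forcing m k| <= W * I.
  rewrite /forcing; apply: le_trans (ler_normD _ _) _.
  apply: le_trans (lerD (ler_normB _ _) (ler_normB _ _)) _.
  rewrite 2!(normrM (_ * _) (Rintegral _ _ _)).
  have := b1 (-2) (-1) (lexx _) le21 le10; have := b1 (-1) 0 le21 le10 (lexx _).
  have := ler_wpM2l (normr_ge0 ((1 - m) * expR (- m) ^+ 2))
    (be (-2) (-1) (lexx _) le21 le10).
  have := ler_wpM2l (normr_ge0 ((2 - (1 - m) * expR (- m)) * expR (- m)))
    (be (-1) 0 le21 le10 (lexx _)).
  by rewrite /W; lra.
have xb : `|x| <= X * (`|y| + I).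
  have -> : x = (charP c m)^-1 * (m * y + c * forcing m k).
    by rewrite -Px mulrA mulVf ?mul1r// gt_eqF.
  rewrite normrM gtr0_norm ?invr_gt0// /X -mulrA; apply: ler_wpM2l.
    by rewrite invr_ge0 ltW.
  apply: le_trans (ler_normD _ _) _; rewrite !normrM (gtr0_norm c0).
  have := ler_wpM2l (ltW c0) Fb.
  have := mulr_ge0 (normr_ge0 m) I0.
  have := mulr_ge0 (mulr_ge0 (ltW c0) W0) (normr_ge0 y).
  by lra.
split.
  apply: le_trans xb _; apply: ler_wpM2r => //.
  by rewrite lerDl mulr_ge0// addr_ge0.
apply/aeIE; apply: filterS fE => t h t20; rewrite h//.
rewrite /trajectory normrM; apply: (@le_trans _ _ (B * ((X + B) * (`|y| + I)))).
  apply: ler_pM => //; first exact: expRM_le.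
  apply: le_trans (ler_normD _ _) _.
  move: t20; rewrite /= in_itv/= => /andP[t2 t0].
  have := be t 0 t2 t0 (lexx _); have := mulr_ge0 B0 (normr_ge0 y).
  by lra.
have := mulr_ge0 X0 S0; lra.
Qed.

(** The scalar equation and [forcing_ge] bound [x] below by [m / 2 / charP c m] times [phi]. In the
    trajectory the contribution of [k] is nonnegative, and [expR (m * -2)] is the least value of the
    exponential on [[-2, 0]]. *)
Lemma real_res_pos c m y k x f : 0 < c -> 0 < m < 6^-1 ->
  mu.-integrable `[-2, 0] (EFin \o k) -> 0 <= y -> aeI (fun t => 0 <= k t) ->
  real_res c m y k x f ->
  let r := expR (m * -2) * (m / 2 / charP c m) *
    (y + c * \int[mu]_(s in `[-2, 0]) k s) in
  r <= x /\ aeI (fun t => r <= f t).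
Proof.
move=> c0 m6 ik y0 k0; have /andP[m0 _] := m6.
have m0' : m != 0 by rewrite gt_eqF.
move=> /(real_resP _ _ _ _ _ _ m0' ik) [_ /aeIE fE Px].
have P0 := charP_gt0 _ _ c0 m0'.
have le20 : (-2 : R) <= 0 by lra.
have /andP[I0 _] := Rintegral_sub_le (-2) 0 _ (lexx _) le20 (lexx _) ik k0.
have N0 := forcing_ge _ _ m6 ik k0.
set I := \int[mu]_(s in `[-2, 0]) k s in I0 N0 *.
set d := m / 2 / charP c m * (y + c * I).
have dx : d <= x.
  rewrite /d mulrAC ler_pdivrMr// mulrC (mulrC x) Px.
  have := ler_wpM2l (ltW c0) N0; have := mulr_ge0 (ltW m0) y0.
  by lra.
have d0 : 0 <= d.
  by rewrite /d mulr_ge0// ?addr_ge0// ?mulr_ge0 ?invr_ge0 ?(ltW P0) ?(ltW m0) ?(ltW c0).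
have e1 : expR (m * -2) <= 1.
  by rewrite -[leRHS]expR0 ler_expR mulrN oppr_le0 mulr_ge0// ltW.
rewrite /= -mulrA -/d; split.
  by apply: le_trans dx; rewrite -[leRHS]mul1r ler_wpM2r.
apply/aeIE; apply: filterS fE => t h t20; rewrite h// /trajectory.
move: t20; rewrite /= in_itv/= => /andP[t2 t0].
apply: ler_pM => //.
  by rewrite ler_expR ler_pM2l.
rewrite -[leLHS]addr0 lerD//; apply: ae_ge0_Rintegral => //.
  by apply: integrable_expRM; exact: integrable_sub_itv ik.
move/aeIE : k0; apply: filterS => s hs /=; rewrite in_itv/= => /andP[s1 s2].
by rewrite mulr_ge0 ?expR_ge0// hs//= in_itv/= s2 (le_trans t2).
Qed.

(** Take reciprocals in [1 + m <= expR m]. *)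
Lemma expRN_le m : - 2^-1 <= m <= 0 -> expR (- m) <= 1 - 2 * m.
Proof.
move=> /andP[m1 m0]; have h := expR_ge1Dx m.
have : expR (- m) * (1 + m) <= 1.
  by rewrite -[leRHS](mulVf (lt0r_neq0 (expR_gt0 m))) -expRN ler_wpM2l// expR_ge0.
have h2 : 1 <= (1 - 2 * m) * (1 + m).
  have : 0 <= - m * (1 + 2 * m) by apply: mulr_ge0; lra.
  lra.
by move=> /le_trans /(_ h2); rewrite ler_pM2r//; lra.
Qed.

(** With [q = expR (- m)], [q - 1 <= - 2 * m] and [q + 1 <= 3] bound the two terms with factor [c]
    by [4 * m ^+ 2] and [6 * m ^+ 2], whence the constant [10]. *)
Lemma charP_le c m : 0 < c -> - 2^-1 <= m <= 0 ->
  charP c m <= m ^+ 2 * (1 + 10 * c).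
Proof.
move=> c0 m12; have q2 := expRN_le _ m12; move/andP : m12 => [m1 m0].
have q1 : 1 <= expR (- m) by rewrite -expR0 ler_expR; lra.
rewrite /charP; move: (expR (- m)) q1 q2 => q q1 q2.
have h1 : (1 - q) ^+ 2 <= (2 * m) ^+ 2.
  by rewrite -sqrrN -[leRHS]sqrrN ler_sqr ?nnegrE; lra.
have h2 : m * (1 - q ^+ 2) <= 6 * m ^+ 2.
  have -> : m * (1 - q ^+ 2) = - m * ((q - 1) * (q + 1)) by ring.
  have -> : 6 * m ^+ 2 = - m * (- 2 * m * 3) by ring.
  by apply: ler_wpM2l; [lra|apply: ler_pM; lra].
have := ler_wpM2l (ltW c0) h1; have := ler_wpM2l (ltW c0) h2.
by lra.
Qed.

(** Here [k] contributes to [f] with the wrong sign, by at most [4] times its integral. The factor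
    [r] gives [r * x <= - 2 * p], and the range of [m] is chosen so that the contribution of [k],
    multiplied by [r], uses up at most one of the two copies of [p]. *)
Lemma real_res_neg c m y k x f : 0 < c -> - (c / (16 * (1 + 10 * c))) < m < 0 ->
  mu.-integrable `[-2, 0] (EFin \o k) -> 0 <= y -> aeI (fun t => 0 <= k t) ->
  real_res c m y k x f ->
  let r := 4 * (- m) * (1 + 10 * c) in
  let p := y + c * \int[mu]_(s in `[-2, 0]) k s in
  r * x <= - p /\ aeI (fun t => r * f t <= - p).
Proof.
move=> c0 /andP[mc m0] ik y0 k0.
have m0' : m != 0 by rewrite lt_eqF.
have b0 : 0 < 1 + 10 * c by lra.
have mb : 16 * (- m) * (1 + 10 * c) <= c.
  have : - m * (16 * (1 + 10 * c)) < c by rewrite -ltr_pdivlMr; lra.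
  by lra.
(* The range of [m] is also small enough, uniformly in [c], for [forcing_le] and [charP_le]. *)
have m4 : - 4^-1 <= m.
  have : (1 + 10 * c) * (- m) <= (1 + 10 * c) * 4^-1 by lra.
  by rewrite ler_pM2l//; lra.
have m11 : -1 < m < 0 by apply/andP; split; lra.
have m12 : - 2^-1 <= m <= 0 by apply/andP; split; lra.
move=> /(real_resP _ _ _ _ _ _ m0' ik) [_ /aeIE fE Px].
have P0 := charP_gt0 _ _ c0 m0'; have Pb := charP_le _ _ c0 m12.
have le20 : (-2 : R) <= 0 by lra.
have /andP[I0 _] := Rintegral_sub_le (-2) 0 _ (lexx _) le20 (lexx _) ik k0.
have N0 := forcing_le _ _ m11 ik k0.
have subI t : -2 <= t -> t <= 0 ->
    \int[mu]_(s in `[t, 0]) k s <= \int[mu]_(s in `[-2, 0]) k s.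
  by move=> t2 t0; have /andP[] := Rintegral_sub_le t 0 _ t2 t0 (lexx _) ik k0.
set I := \int[mu]_(s in `[-2, 0]) k s in I0 N0 subI *.
move=> r p.
have p0 : 0 <= p by rewrite /p addr_ge0// mulr_ge0// ltW.
have r0 : 0 < r by rewrite /r !mulr_gt0//; lra.
have Px' : charP c m * x <= m / 2 * p.
  rewrite Px /p; have := ler_wpM2l (ltW c0) N0.
  have : m * y <= m / 2 * y by rewrite -mulrA; apply: ler_wnM2l; lra.
  by lra.
have x0 : x <= 0.
  have h : m / 2 * p <= 0 by rewrite mulr_le0_ge0//; lra.
  by have := le_trans Px' h; rewrite pmulr_rle0.
(* Since [x <= 0], the upper bound on [charP] applies; dividing by the negative number [m / 2] then
   reverses the inequality. *)
have rx : r * x <= - 2 * p.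
  have : m ^+ 2 * (1 + 10 * c) * x <= m / 2 * p.
    by apply: le_trans Px'; apply: ler_wnM2r.
  have -> : m ^+ 2 * (1 + 10 * c) * x = m / 2 * (2 * m * (1 + 10 * c) * x) by field.
  by rewrite ler_nM2l; [rewrite /r; lra|lra].
split; first by lra.
apply/aeIE; apply: filterS fE => t h t20; rewrite h//.
move: t20; rewrite /= in_itv/= => /andP[t2 t0].
have fx : trajectory m x k t <= x + 4 * I.
  rewrite /trajectory mulrDr; apply: lerD.
    rewrite -[leRHS]mul1r; apply: ler_wnM2r => //.
    by rewrite -[leLHS]expR0 ler_expR; apply: mulr_le0; lra.
  (* The exponent is at most [- 2 * m], and [expR (- m) <= 2]. *)
  have e4 : expR (m * t) <= 4.
    apply: (@le_trans _ _ (expR (- m) * expR (- m))).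
      by rewrite -expRD ler_expR; have := ler_wnM2l (ltW m0) t2; lra.
    have -> : (4 : R) = 2 * 2 by ring.
    by have := expRN_le _ m12; have := expR_ge0 (- m); move=> ? ?; apply: ler_pM; lra.
  have ikt := integrable_sub_itv t2 (lexx _) ik.
  have L0 : 0 <= \int[mu]_(s in `[t, 0]) (expR (- m * s) * k s).
    apply: ae_ge0_Rintegral => //; first exact: integrable_expRM.
    move/aeIE : k0; apply: filterS => s hs /=; rewrite in_itv/= => /andP[s1 s2].
    by rewrite mulr_ge0 ?expR_ge0// hs//= in_itv/= s2 (le_trans t2).
  apply: ler_pM => //.
  apply: le_trans (subI t t2 t0); apply: ae_le_Rintegral => //.
    exact: integrable_expRM.
  move/aeIE : k0; apply: filterS => s hs /=; rewrite in_itv/= => /andP[s1 s2].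
  rewrite -[leRHS]mul1r ler_wpM2r//.
    by rewrite hs//= in_itv/= s2 (le_trans t2).
  by rewrite -[leRHS]expR0 ler_expR; apply: mulr_ge0_le0; lra.
have h1 := ler_wpM2l (ltW r0) fx.
have h2 : r * (4 * I) <= c * I.
  have -> : r * (4 * I) = 16 * (- m) * (1 + 10 * c) * I by rewrite /r; ring.
  by rewrite ler_wpM2r.
have : c * I <= p by rewrite /p lerDr.
by lra.
Qed.

End real_resolvent.

(** * Passage from the real problem to complex data *)

Section complex_resolvent.
Local Open Scope complex_scope.
Context {R : realType}.
Notation mu := (@lebesgue_measure R).
Notation Re := (@complex.Re R).
Notation Im := (@complex.Im R).
Implicit Types (c m : R) (z w : R[i]) (k h : Elt R).

Lemma ReB z w : Re (z - w) = Re z - Re w. Proof. by case: z w => ? ? []. Qed.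
Lemma ImB z w : Im (z - w) = Im z - Im w. Proof. by case: z w => ? ? []. Qed.
Lemma ReD z w : Re (z + w) = Re z + Re w. Proof. by case: z w => ? ? []. Qed.
Lemma ImD z w : Im (z + w) = Im z + Im w. Proof. by case: z w => ? ? []. Qed.
Lemma ReCM (r : R) z : Re (r%:C * z) = r * Re z.
Proof. by case: z => a b /=; rewrite mul0r subr0. Qed.
Lemma ImCM (r : R) z : Im (r%:C * z) = r * Im z.
Proof. by case: z => a b /=; rewrite mul0r addr0. Qed.
Lemma eqReIm z w : Re z = Re w -> Im z = Im w -> z = w.
Proof. by case: z w => ? ? [? ?] /= -> ->. Qed.

Lemma complex_ge0 z : 0 <= z <-> 0 <= Re z /\ Im z = 0.
Proof.
rewrite lecE /=; split=> [/andP[/eqP -> ->]//|[-> ->]].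
by rewrite eqxx.
Qed.

Lemma aeI_map (P Q : R -> Prop) : (forall t, P t -> Q t) -> aeI P -> aeI Q.
Proof.
by move=> PQ /aeIE aP; apply/aeIE; apply: filterS aP => t h /h /PQ.
Qed.

Lemma aeI_map2 (P Q S : R -> Prop) : (forall t, P t -> Q t -> S t) ->
  aeI P -> aeI Q -> aeI S.
Proof.
move=> PQS /aeIE aP /aeIE aQ; apply/aeIE.
by apply: filterS2 aP aQ => t h1 h2 It; apply: PQS; [exact: h1|exact: h2].
Qed.

Lemma aeI_and (P Q : R -> Prop) : aeI P -> aeI Q -> aeI (fun t => P t /\ Q t).
Proof. exact: aeI_map2. Qed.

(** [Phi] and [m] have real coefficients, and two real weak derivatives combine into one complex
    weak derivative. *)
Lemma res_realP c m k h : res c m%:C k h <->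
  real_res c m (Re k.1) (fun t => Re (k.2 t)) (Re h.1) (fun t => Re (h.2 t)) /\
  real_res c m (Im k.1) (fun t => Im (k.2 t)) (Im h.1) (fun t => Im (h.2 t)).
Proof.
split.
  move=> [z [[g [[[iR iI] [[gR gI] hg]] [z1 zg]]] [e1 e2]]].
  move: e1 e2; rewrite /= z1 mulN1r => e1 e2.
  split; [exists (fun t => Re (g t))|exists (fun t => Im (g t))]; split => //.
  - by apply: aeI_map hg => t ->; rewrite ReB.
  - by rewrite -e1 ReB !ReCM !ReB ReD !ReB /=; ring.
  - by apply: aeI_map2 zg e2 => t /= zt <-; rewrite zt mulN1r ReB ReCM.
  - by apply: aeI_map hg => t ->; rewrite ImB.
  - by rewrite -e1 ImB !ImCM !ImB ImD !ImB /=; ring.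
  - by apply: aeI_map2 zg e2 => t /= zt <-; rewrite zt mulN1r ImB ImCM.
move=> [[gR [[iR igR] fR eR kR]] [gI [[iI igI] fI eI kI]]].
pose g t := Complex (gR t) (gI t).
exists (PhiA c h g, g); split.
  exists g; split; last first.
    by split => //; apply/aeIE; exact: filterE.
  split; first by split.
  split; first by split.
  apply: aeI_map2 fR fI => t eqR eqI.
  by apply: eqReIm; rewrite ?ReB ?ImB ?eqR ?eqI.
split.
  apply: eqReIm => /=; rewrite mulN1r.
    by rewrite -eR ReB !ReCM !ReB ReD !ReB /=; ring.
  by rewrite -eI ImB !ImCM !ImB ImD !ImB /=; ring.
apply: aeI_map2 kR kI => t eqR eqI /=; rewrite mulN1r.
by apply: eqReIm; rewrite ?ReB ?ImB ?ReCM ?ImCM.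
Qed.

(** The complex norm takes its values in [R[i]]; [nr] is the same modulus as a real number, so that
    it can be integrated and compared in [R]. *)
Let nr z : R := Num.sqrt (Re z ^+ 2 + Im z ^+ 2).

Let nrE z : `|z| = (nr z)%:C. Proof. exact: normc_def. Qed.

Let nr_ge0 z : 0 <= nr z. Proof. exact: sqrtr_ge0. Qed.

Let Re_le_nr z : `|Re z| <= nr z.
Proof. by rewrite -sqrtr_sqr ler_wsqrtr// lerDl sqr_ge0. Qed.

Let Im_le_nr z : `|Im z| <= nr z.
Proof. by rewrite -sqrtr_sqr ler_wsqrtr// lerDr sqr_ge0. Qed.

Let nr_le z : nr z <= `|Re z| + `|Im z|.
Proof.
rewrite -[leRHS]ger0_norm ?addr_ge0// -sqrtr_sqr ler_wsqrtr//.
rewrite sqrrD !real_normK ?num_real//.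
have : 0 <= `|Re z| * `|Im z| by rewrite mulr_ge0.
by rewrite mulr2n; move: (_ * _) => p; lra.
Qed.

Let nr_integrable (f : R -> R[i]) : cintegrable `[-2, 0]%classic f ->
  mu.-integrable `[-2, 0] (EFin \o (fun t => nr (f t))).
Proof.
move=> [iR iI].
have iS := integrable_funD _ _ _ (measurable_itv _)
  (integrable_norm iR) (integrable_norm iI).
apply: le_integrable iS => //.
  apply/measurable_EFinP; apply: measurableT_comp.
    by apply: continuous_measurable_fun; exact: sqrt_continuous.
  apply: measurable_funD; apply: measurable_funX; apply/measurable_EFinP.
    exact: measurable_int iR.
  exact: measurable_int iI.
move=> t _ /=; rewrite lee_fin ger0_norm//.
by rewrite [leRHS]ger0_norm ?addr_ge0.
Qed.

Let normE_real h :
  normE h = (nr h.1 + \int[mu]_(t in `[-2, 0]) nr (h.2 t))%:C.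
Proof.
rewrite /normE nrE (_ : (fun t => `|h.2 t|) = (fun t => (nr (h.2 t))%:C)).
  apply: eqReIm; rewrite ?ReD ?ImD //=.
  by rewrite add0r Rintegral_cst ?mul0r//; exact: measurable_itv.
by apply/funext => t; exact: nrE.
Qed.

Lemma in_resolvent_set_real c m : 0 < c -> m != 0 -> in_resolvent_set c m%:C.
Proof.
move=> c0 m0; split; last split.
- move=> k [kR kI].
  have [xR [fR sR]] := real_res_exists _ _ (Re k.1) _ c0 m0 kR.
  have [xI [fI sI]] := real_res_exists _ _ (Im k.1) _ c0 m0 kI.
  by exists (Complex xR xI, fun t => Complex (fR t) (fI t)); apply/res_realP.
- move=> k h1 h2 [kR kI] /res_realP[R1 I1] /res_realP[R2 I2].
  have [e1 e2] := real_res_unique _ _ _ _ _ _ _ _ c0 m0 kR R1 R2.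
  have [e3 e4] := real_res_unique _ _ _ _ _ _ _ _ c0 m0 kI I1 I2.
  split; first exact: eqReIm.
  by apply: aeI_map2 e2 e4 => t; exact: eqReIm.
have [K [K0 bd]] := real_res_bound _ _ c0 m0.
(* Real and imaginary parts together give [2 * K] for the scalar component; the same pointwise bound
   over an interval of length [2] gives [4 * K] for the function. *)
exists (6 * K) => k h ik /res_realP[sR sI].
have ih : Defs.inE h.
  by split; [case: sR => g [[]]|case: sI => g [[]]].
have [iR iI] := ik.
have [xR /aeIE fR] := bd _ _ _ _ iR sR; have [xI /aeIE fI] := bd _ _ _ _ iI sI.
rewrite !normE_real -(rmorphM (real_complex R)) lecR.
have ink := nr_integrable _ ik; have inh := nr_integrable _ ih.
set N := nr k.1 + \int[mu]_(t in `[-2, 0]) nr (k.2 t).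
have NR : K * (`|Re k.1| + \int[mu]_(t in `[-2, 0]) `|Re (k.2 t)|) <= K * N.
  apply: ler_wpM2l => //; apply: lerD => //; apply: le_Rintegral => //.
  exact: integrable_norm iR.
have NI : K * (`|Im k.1| + \int[mu]_(t in `[-2, 0]) `|Im (k.2 t)|) <= K * N.
  apply: ler_wpM2l => //; apply: lerD => //; apply: le_Rintegral => //.
  exact: integrable_norm iI.
have h1 : nr h.1 <= 2 * (K * N).
  by apply: le_trans (nr_le _) _; lra.
have h2 : \int[mu]_(t in `[-2, 0]) nr (h.2 t) <= 4 * (K * N).
  apply: (@le_trans _ _ (\int[mu]_(t in `[-2, 0]) (2 * (K * N)))).
    apply: ae_le_Rintegral => //.
      by apply: integrable_itv_continuous => t; exact: cvg_cst.
    apply: filterS2 fR fI => t hR hI It; apply: le_trans (nr_le _) _.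
    by have := hR It; have := hI It; lra.
  have V : fine (mu `[(-2 : R), 0]%classic) = 2.
    by rewrite lebesgue_measure_itv/= lte_fin ifT /=; lra.
  rewrite (_ : \int[mu]_(t in `[-2, 0]) _ = 2 * (K * N) * 2); first by lra.
  by rewrite -[X in _ = _ * X]V; exact: Rintegral_cst.
lra.
Qed.

(** Positive data have imaginary part zero almost everywhere, so the imaginary part of the solution
    solves the problem with zero data and vanishes. Positivity thus becomes a question about the
    real problem. *)
Lemma res_real_data c m k h : 0 < c -> m != 0 -> Defs.inE k -> Defs.posE k ->
  res c m%:C k h ->
  [/\ 0 <= Re k.1 /\ aeI (fun t => 0 <= Re (k.2 t)),
      Im h.1 = 0 /\ aeI (fun t => Im (h.2 t) = 0),
      real_res c m (Re k.1) (fun t => Re (k.2 t)) (Re h.1) (fun t => Re (h.2 t)) &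
      phiE c k = (Re k.1 + c * \int[mu]_(t in `[-2, 0]) Re (k.2 t))%:C].
Proof.
move=> c0 m0 [iR iI] [/complex_ge0[k1R k1I] k2] /res_realP[sR sI].
have k2R : aeI (fun t => 0 <= Re (k.2 t)).
  by apply: aeI_map k2 => t /complex_ge0[].
have k2I : aeI (fun t => Im (k.2 t) = 0).
  by apply: aeI_map k2 => t /complex_ge0[].
have i0 : mu.-integrable `[-2, 0] (EFin \o (fun=> 0 : R)).
  by apply: integrable_itv_continuous => t; exact: cvg_cst.
have J0 (u : R -> R) : mu.-integrable `[-2, 0] (EFin \o u) ->
    aeI (fun t => u t = 0) -> \int[mu]_(t in `[-2, 0]) u t = 0.
  move=> iu /aeIE u0; rewrite (ae_eq_Rintegral _ _ _ _ iu i0 u0)//.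
  by rewrite Rintegral_cst// mul0r.
split => //; last first.
  apply: eqReIm; rewrite /phiE ?ReD ?ImD ?ReCM ?ImCM//=.
  by rewrite k1I J0// mulr0 addr0.
have [K [K0 bd]] := real_res_bound _ _ c0 m0.
have [] := bd _ _ _ _ iI sI.
rewrite k1I normr0 add0r J0; last 2 first.
- exact: integrable_norm iI.
- by apply: aeI_map k2I => t ->; rewrite normr0.
rewrite mulr0 normr_le0 => /eqP -> f0; split => //.
by apply: aeI_map f0 => t; rewrite normr_le0 => /eqP.
Qed.

End complex_resolvent.

Theorem theorem6p11 (R : realType) (c : R) (hc : 0 < c) :
  (exists eps : R, 0 < eps /\
     forall m : R, 0 < m < eps ->
       in_resolvent_set c (m%:C)%C /\
       op_succeq (res c (m%:C)%C) (rank1 c)) /\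
  (exists eps : R, 0 < eps /\
     forall m : R, - eps < m < 0 ->
       in_resolvent_set c (m%:C)%C /\
       op_succeq (neg_op (rank1 c)) (res c (m%:C)%C)).
Proof.
split.
  (* The range of [m] in [real_res_pos]; it does not depend on [c]. *)
  exists 6^-1; split; first by rewrite invr_gt0.
  move=> m m6; have /andP[m0 _] := m6.
  have m0' : m != 0 by rewrite gt_eqF.
  split; first exact: in_resolvent_set_real.
  (* The factor of [phi] in the lower bound of [real_res_pos]. *)
  exists (expR (m * -2) * (m / 2 / charP c m)); split.
    by rewrite !mulr_gt0 ?expR_gt0// invr_gt0 charP_gt0.
  move=> k h ik pk [w [v [kw [[v1 v2] [h1 h2]]]]].
  have [[k1 k2] [w1I w2I] sR phi] := res_real_data _ _ _ _ hc m0' ik pk kw.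
  have [xR fR] := real_res_pos _ _ _ _ _ _ hc m6 ik.1 k1 k2 sR.
  rewrite phi /= in v1 v2.
  split.
    apply/complex_ge0; rewrite h1 /= v1 mulr1 mulNr.
    rewrite ReB ImB ReCM ImCM /= mulr0 w1I subrr; split => //.
    by rewrite subr_ge0.
  move: (aeI_and _ _ w2I fR) (aeI_and _ _ v2 h2).
  apply: aeI_map2 => t [wI wR] [vt ht].
  apply/complex_ge0; rewrite ht /= vt mulr1 mulNr.
  rewrite ReB ImB ReCM ImCM /= mulr0 wI subrr; split => //.
  by rewrite subr_ge0.
have b0 : 0 < 1 + 10 * c by lra.
exists (c / (16 * (1 + 10 * c))); split.
  by rewrite divr_gt0// mulr_gt0.
move=> m mc; have /andP[_ m0] := mc.
have m0' : m != 0 by rewrite lt_eqF.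
split; first exact: in_resolvent_set_real.
(* The rank-one operator is now on the larger side, so the constant multiplies the resolvent: it is
   the factor [r] of [real_res_neg]. *)
exists (4 * (- m) * (1 + 10 * c)); split.
  by rewrite !mulr_gt0// oppr_gt0.
(* Here [p] is the value of the rank-one operator at [k], [w] its negative, and [v] the value of the
   resolvent. *)
move=> k h ik pk [w [v [[p [[p1 p2] [w1 w2]]] [kv [h1 h2]]]]].
have [[k1 k2] [v1I v2I] sR phi] := res_real_data _ _ _ _ hc m0' ik pk kv.
have [xR fR] := real_res_neg _ _ _ _ _ _ hc mc ik.1 k1 k2 sR.
rewrite phi /= in p1 p2.
split.
  apply/complex_ge0; rewrite h1 /= w1 /= p1 mulr1 mulN1r mulNr -opprD.
  rewrite -sub0r ReB ImB ReD ImD ReCM ImCM /= v1I mulr0 addr0 subrr.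
  by split => //; lra.
move: (aeI_and _ _ v2I fR) (aeI_and _ _ (aeI_and _ _ p2 w2) h2).
apply: aeI_map2 => t [vI vR] [[pt wt] ht].
apply/complex_ge0; rewrite ht /= wt /= pt mulr1 mulN1r mulNr -opprD.
rewrite -sub0r ReB ImB ReD ImD ReCM ImCM /= vI mulr0 addr0 subrr.
by split => //; lra.
Qed.
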